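(* Let $b>0$, $\delta>0$, $\eta>0$ and $0\le v<1$ be real constants, let $$K=1+\delta\max\Big\{\frac{1+2\delta/\pi}{\pi(1-v^2)},\ \frac{2\eta}{b}\Big\},$$ and let $\varepsilon$ be a real number with $$0<\varepsilon<\frac{2\delta(1-v-v^2)}{K(1-v^2)}.$$ Let $F:(0,1)\times\mathbb{R}_+\to\mathbb{R}$ belong to $X_\infty$, and let $y(x,t)\in\mathbb{R}$ be the solution of $$y_{tt}+2\delta y_t+2v\,y_{xt}=\Big[1-v^2+\tfrac32 b\,y_x^2\Big]y_{xx}+2\eta\,y_x y_{xx}y_{xt}+\eta\,y_x^2\,y_{xxt}+F(x,t),\qquad x\in(0,1),\ t\ge 0,$$ with boundary conditions $y(0,t)=y(1,t)=0$ for all $t\ge0$ and initial conditions $y(x,0)=0$, $y_t(x,0)=0$ for all $x\in(0,1)$. Then $y$ is bounded (i.e. $y\in X_\infty$) and $$\|y\|_{X_\infty}\le\left(\frac{K}{\varepsilon\big[(2\delta-\varepsilon K)(1-v^2)-2\delta v\big]}\right)^{1/2}\|F\|_{X_2}<\infty.$$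
   Context: Subscripts denote partial derivatives, e.g. $y_x=\partial y/\partial x$, $y_{xt}=\partial^2y/\partial x\partial t$, $y_{xxt}=\partial^3 y/\partial x^2\partial t$. $X_2$ is the space of functions $u:(0,1)\times\mathbb{R}_+\to\mathbb{R}$ with $\|u\|_{X_2}:=\sup_{t\ge0}\big[\int_0^1|u(x,t)|^2dx\big]^{1/2}<\infty$, and $X_\infty$ is the space of functions $u:(0,1)\times\mathbb{R}_+\to\mathbb{R}$ with $\|u\|_{X_\infty}:=\sup_{t\ge0}\sup_{x\in(0,1)}|u(x,t)|<\infty$; one has $X_\infty\subset X_2$. The problem models a nonlinear axially moving string between two fixed eyelets with viscous damping $\delta$, Kelvin-Voigt damping $\eta$, axial speed proportional to $v$, and a distributed transversal force $F$. A solution is understood to be regular enough on $[0,1]\times[0,\infty)$ that all displayed derivatives exist, the boundary and initial conditions hold in the classical sense, and integration by parts in $x$ and differentiation in $t$ under integrals over $x\in[0,1]$ of polynomial expressions in $y,y_t,y_x$ are legitimate. *)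

(* Defs.v *)
From HB Require Import structures.
From mathcomp Require Import all_boot all_order all_algebra.
From mathcomp Require Import all_classical all_reals all_analysis.
Import Order.TTheory GRing.Theory Num.Theory.
Import numFieldNormedType.Exports.

Set Implicit Arguments.
Unset Strict Implicit.
Unset Printing Implicit Defensive.

Local Open Scope classical_set_scope.
Local Open Scope ring_scope.

(** Functions of [(x, t)] are curried maps [R -> R -> R]. Only their values for
    [x] in [0, 1] (or in the open interval) and [t >= 0] are ever used: the
    values elsewhere are arbitrary. *)

Section derivatives.
Context {R : realType}.
Implicit Types (A : set R) (f : R -> R) (u : R -> R -> R).

(** Derivative of [f] at [a] along the domain [A]: one-sided when [a] is an
    end point of the interval [A], the ordinary derivative inside [A]. *)
Definition slope f (a : R) : R -> R := fun s => (f s - f a) / (s - a).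

Definition derivable_in A f (a : R) : Prop := cvg (slope f a @ within A a^').

Definition derive_in A f (a : R) : R := lim (slope f a @ within A a^').

Definition Dx u : R -> R -> R := fun x t => derive_in `[0, 1] (u ^~ t) x.

Definition Dt u : R -> R -> R := fun x t => derive_in `[0, +oo[ (u x) t.

Definition derivable_x u : Prop :=
  forall x t, 0 <= x <= 1 -> 0 <= t -> derivable_in `[0, 1] (u ^~ t) x.

Definition derivable_t u : Prop :=
  forall x t, 0 <= x <= 1 -> 0 <= t -> derivable_in `[0, +oo[ (u x) t.

End derivatives.

Section spaces.
Context {R : realType}.
Implicit Types u : R -> R -> R.

Definition Xinfty_norm u : \bar R :=
  ereal_sup [set ereal_sup [set `|u x t|%:E | x in `]0, 1[] | t in `[0, +oo[].

Definition X2_norm u : \bar R :=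
  ereal_sup [set ((\int[lebesgue_measure]_(x in `]0%R, 1%R[) (`|u x t| ^+ 2)%:E)
                  `^ 2^-1)%E | t in `[0, +oo[].

(** Needed for the integral over [x] to be meaningful; required in both spaces
    because [Xinfty] is to be contained in [X2]. *)
Definition measurable_in_x u : Prop :=
  forall t, 0 <= t -> measurable_fun (`]0, 1[ : set R) (u ^~ t).

Definition Xinfty : set (R -> R -> R) :=
  [set u | measurable_in_x u /\ (Xinfty_norm u < +oo)%E].

Definition X2 : set (R -> R -> R) :=
  [set u | measurable_in_x u /\ (X2_norm u < +oo)%E].

End spaces.

Section solutions.
Context {R : realType}.
Implicit Types u y F p q : R -> R -> R.

Inductive poly_expr (G : set (R -> R -> R)) : (R -> R -> R) -> Prop :=
| poly_cst (c : R) : poly_expr G (fun _ _ => c)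
| poly_gen u : G u -> poly_expr G u
| poly_add p q : poly_expr G p -> poly_expr G q ->
    poly_expr G (fun x t => p x t + q x t)
| poly_mul p q : poly_expr G p -> poly_expr G q ->
    poly_expr G (fun x t => p x t * q x t).

Definition integrable_x u (t : R) : Prop :=
  (@lebesgue_measure R).-integrable `[0, 1] (EFin \o (u ^~ t)).

Definition int_x u (t : R) : R :=
  \int[lebesgue_measure]_(x in `[0, 1]) u x t.

Definition diff_under_int p : Prop := forall t, 0 <= t ->
  [/\ integrable_x p t, integrable_x (Dt p) t,
      derivable_in `[0, +oo[ (int_x p) t &
      derive_in `[0, +oo[ (int_x p) t = int_x (Dt p) t].

Definition int_by_parts p q : Prop := forall t, 0 <= t ->
  [/\ integrable_x (fun x s => p x s * Dx q x s) t,
      integrable_x (fun x s => Dx p x s * q x s) t &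
      int_x (fun x s => p x s * Dx q x s) t =
      p 1 t * q 1 t - p 0 t * q 0 t - int_x (fun x s => Dx p x s * q x s) t].

(** Existence up to the boundary of all the derivatives occurring in the
    equation, the order of differentiation in [y_xt] being immaterial, together
    with the validity of the two manipulations of integrals over [0, 1].
    Differentiating in [t] an integral of a polynomial in [y, y_t, y_x] and
    substituting the equation produces the [x]-derivative of
    [(1 - v^2) y_x + (b / 2) y_x^3 + eta y_x^2 y_xt]; for this reason [y_xt]
    is also allowed in the integrations by parts. All of this holds
    as soon as [y] and the derivatives listed here are continuous on
    [0, 1] x [0, +oo[. *)
Record regular y : Prop := Regular {
  regular_t : derivable_t y;
  regular_tt : derivable_t (Dt y);
  regular_x : derivable_x y;
  regular_xx : derivable_x (Dx y);
  regular_xt : derivable_x (Dt y);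
  regular_tx : derivable_t (Dx y);
  regular_mixed : forall x t, 0 <= x <= 1 -> 0 <= t ->
    Dt (Dx y) x t = Dx (Dt y) x t;
  regular_xxt : derivable_x (Dx (Dt y));
  regular_diff : forall p, poly_expr [set y; Dt y; Dx y] p ->
    diff_under_int p;
  regular_parts : forall p q,
    poly_expr [set y; Dt y; Dx y; Dx (Dt y)] p ->
    poly_expr [set y; Dt y; Dx y; Dx (Dt y)] q ->
    int_by_parts p q
}.

Definition string_equation (b delta eta v : R) F y : Prop :=
  forall x t, 0 < x < 1 -> 0 <= t ->
    Dt (Dt y) x t + 2 * delta * Dt y x t + 2 * v * Dx (Dt y) x t =
    (1 - v ^+ 2 + 3 / 2 * b * Dx y x t ^+ 2) * Dx (Dx y) x t
    + 2 * eta * Dx y x t * Dx (Dx y) x t * Dx (Dt y) x t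
    + eta * Dx y x t ^+ 2 * Dx (Dx (Dt y)) x t
    + F x t.

Record string_solution (b delta eta v : R) F y : Prop := StringSolution {
  solution_regular : regular y;
  solution_equation : string_equation b delta eta v F y;
  solution_boundary : forall t, 0 <= t -> y 0 t = 0 /\ y 1 t = 0;
  solution_initial : forall x, 0 < x < 1 -> y x 0 = 0 /\ Dt y x 0 = 0
}.

End solutions.

(* Main.v *)
(** Write [a] for [1 - v^2]. The Lyapunov function is
      [V = int_0^1 y_t^2/2 + a y_x^2/2 + (b/8 + delta eta/4) y_x^4
                   + delta y y_t + delta^2 y^2].
    Substituting the equation in [V'] and integrating by parts gives
    [V' + e V <= (1 + delta^2/6) / (2 D) ||F||^2] with
    [D = (2 delta - e K') a - 2 delta v], as soon as [V <= K' E] for the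
    energy [E] of the string. Since [V] starts at [0], it stays below the value
    at which this forces [V' < 0], and [2 a y^2 <= V] then bounds [y].

    The constant [K] of the theorem stems from the optimal Poincare constant
    [1/pi^2]. The constant [1/6] used here, read off [y^2 <= x (1-x) int y_x^2],
    only yields a larger [K']; with the slower rate [e = eps K / K'] the
    product [e K'], hence [D], is unchanged, and the loss in the final bound is
    absorbed because [(1 + delta^2/6) K' <= 4 a K^2]. *)
Require Import Defs.
From HB Require Import structures.
From mathcomp Require Import all_boot all_order all_algebra.
From mathcomp Require Import all_classical all_reals all_analysis.
From mathcomp Require Import measurable_realfun ring lra.
Import Order.TTheory GRing.Theory Num.Theory.
Import numFieldNormedType.Exports.
Local Open Scope classical_set_scope.
Local Open Scope ring_scope.

Set Implicit Arguments.
Unset Strict Implicit.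
Unset Printing Implicit Defensive.

(** * One-sided derivatives as limits of slopes along a set *)

Section derivatives_along_a_set.
Context {R : realType}.
Implicit Types (A : set R) (f g : R -> R) (a l m : R).

(** Relational form of [derive_in]: the sum and product rules hold for any filter, and uniqueness of
    limits, which needs a proper filter, is left to [has_slope_derive]. *)
Definition has_slope A f a l := slope f a @ within A a^' --> l.

Lemma derive_inP A f a : derivable_in A f a ->
  has_slope A f a (derive_in A f a).
Proof. by []. Qed.

Lemma has_slope_derive A f a l : ProperFilter (within A a^') ->
  has_slope A f a l -> derive_in A f a = l.
Proof. by move=> PF fl; apply/cvg_lim. Qed.

Lemma has_slope_cst A c a : has_slope A (fun=> c) a 0.
Proof.
rewrite /has_slope (_ : slope _ a = fun=> 0); first exact: cvg_cst.
by apply/funext => s; rewrite /slope subrr mul0r.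
Qed.

Lemma has_slopeD A f g a l m : has_slope A f a l -> has_slope A g a m ->
  has_slope A (fun s => f s + g s) a (l + m).
Proof.
move=> fl gm; rewrite /has_slope (_ : slope _ a = slope f a \+ slope g a).
  exact: cvgD fl gm.
by apply/funext => s; rewrite /slope /= -mulrDl opprD addrACA.
Qed.

Lemma has_slope_cvg A f a l : has_slope A f a l -> f @ within A a^' --> f a.
Proof.
move=> fl.
have h : (fun s => f a + slope f a s * (s - a)) @ within A a^' --> f a + l * (a - a).
  apply: cvgD; first exact: cvg_cst.
  apply: cvgM => //; apply: cvgB; last exact: cvg_cst.
  by apply: cvg_within_filter; apply: cvg_within_filter; exact: cvg_id.
rewrite subrr mulr0 addr0 in h.
apply: cvg_trans h; apply: near_eq_cvg.
rewrite near_withinE near_withinE; apply: nearW => s sa _.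
by rewrite /slope mulfVK ?subr_eq0// addrC subrK.
Qed.

Lemma has_slopeM A f g a l m : has_slope A f a l -> has_slope A g a m ->
  has_slope A (fun s => f s * g s) a (l * g a + f a * m).
Proof.
move=> fl gm; rewrite /has_slope
  (_ : slope _ a = (slope f a \* g) \+ (fun s => f a * slope g a s)).
  by apply: cvgD; [apply: cvgM fl (has_slope_cvg gm)|apply: cvgM => //; exact: cvg_cst].
by apply/funext => s; rewrite /slope /=; ring.
Qed.

(** The punctured limit is the value [f a] itself, so the point [a] can be put back; this is the
    form required by continuity on a subspace. *)
Lemma derivable_in_cvg A f a : derivable_in A f a -> f @ within A (nbhs a) --> f a.
Proof.
move=> /derive_inP/has_slope_cvg fa U /[dup] /fa h /nbhs_singleton Ufa.
move: h; rewrite /nbhs /= /within /= !near_simpl /= => h.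
rewrite near_withinE in h.
near=> s => As; have [->//|sa] := eqVneq s a.
by have := near h s; apply.
Unshelve. all: by end_near. Qed.

Lemma has_slope_subset A B f a l : B `<=` A -> has_slope A f a l ->
  has_slope B f a l.
Proof.
by move=> BA; apply: cvg_trans; apply: cvg_app; apply: within_subset.
Qed.

Lemma has_slope_interior A f a l : nbhs a A -> has_slope A f a l ->
  is_derive a 1 f l.
Proof.
move=> aA fl.
have h : (slope f a \o shift a) @ 0^' --> l.
  apply: (@cvg_comp _ _ _ (shift a) (slope f a) 0^' (within A a^')) => //.
  move=> U; rewrite /= /within /= nbhs_simpl => aU.
  have {}aU : \forall x \near a, x != a -> U x.
    have {}aU : \forall x \near a, x != a -> A x -> U x by [].
    by apply: filterS2 aA aU => x Ax; move=> h /h; exact.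
  move/nbhs0P : aU; rewrite /dnbhs /within /=; apply: filterS => h /=.
  rewrite (addrC a) => Uh h0; apply: Uh.
  by rewrite -subr_eq0 addrK.
have {}h : (fun h => h^-1 *: ((f \o shift a) (h *: 1) - f a)) @ 0^' --> l.
  apply: cvg_trans h; apply: near_eq_cvg; apply: nearW => h /=.
  by rewrite /slope addrK mulrC [h *: 1]mulr1.
by split; [apply/cvg_ex; exists l|exact/cvg_lim].
Qed.

(** Every point of a nondegenerate segment can be approached from the left or from the right inside
    it, so limits along [A] are unique there. *)
Lemma proper_within_itv A a b c : a < b -> a <= c <= b ->
  `[a, b] `<=` A -> ProperFilter (within A c^').
Proof.
move=> ab /andP[ac cb] abA; apply: Build_ProperFilter_ex => U AU.
have /orP[{}ac|{}cb] : (a < c) || (c < b).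
  by move: ac; rewrite le_eqVlt => /orP[/eqP<-|->//]; rewrite ab orbT.
- have : \forall x \near c^'-, U x.
    move: AU; rewrite /within /= nearE /= => AU.
    have {}AU : \forall x \near c, x != c -> A x -> U x by [].
    rewrite /at_left /within /=; near=> x => xc.
    apply: (near AU x) => //; first by rewrite lt_eqF.
    apply: abA; rewrite /= in_itv /= (ltW (lt_le_trans xc cb)) andbT.
    by near: x; exact: lt_le_nbhsr.
  by apply: (@filter_ex _ _ (at_left_proper_filter c)).
- have : \forall x \near c^'+, U x.
    move: AU; rewrite /within /= nearE /= => AU.
    have {}AU : \forall x \near c, x != c -> A x -> U x by [].
    rewrite /at_right /within /=; near=> x => xc.
    apply: (near AU x) => //; first by rewrite gt_eqF.
    apply: abA; rewrite /= in_itv /= (ltW (le_lt_trans ac xc)) /=.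
    by near: x; exact: lt_le_nbhsl.
  by apply: (@filter_ex _ _ (at_right_proper_filter c)).
Unshelve. all: by end_near. Qed.

End derivatives_along_a_set.

(** * Fundamental theorem of calculus and a Poincare inequality on an interval *)

Section interval_inequalities.
Context {R : realType}.
Local Notation mu := lebesgue_measure.
Implicit Types (f g : R -> R) (a b c d x : R).

Lemma derivable_in_continuous c d f :
  (forall x, c <= x <= d -> derivable_in `[c, d] f x) ->
  {within `[c, d], continuous f}.
Proof.
move=> df; apply/subspace_continuousP => x; rewrite /= in_itv /= => xcd.
exact/derivable_in_cvg/df.
Qed.

Lemma continuous_integrable a b f : {within `[a, b], continuous f} ->
  mu.-integrable `[a, b] (EFin \o f).
Proof.
by move=> cf; apply: continuous_compact_integrable => //; exact: segment_compact.
Qed.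

Lemma within_continuousM (A : set R) f g : {within A, continuous f} ->
  {within A, continuous g} -> {within A, continuous (fun x => f x * g x)}.
Proof. by move=> cf cg x; apply: cvgM; [exact: cf|exact: cg]. Qed.

Lemma within_continuous_cst (A : set R) c : {within A, continuous (fun=> c)}.
Proof. by move=> x; exact: cvg_cst. Qed.

Lemma itv_interior a b c d x : c <= a -> b <= d -> x \in `]a, b[ ->
  nbhs x [set` `[c, d]].
Proof.
move=> ca bd xab; apply: filterS (near_in_itvoo xab) => z /=.
rewrite !in_itv /= => /andP[az zb].
by rewrite (le_trans ca (ltW az)) (le_trans (ltW zb) bd).
Qed.

(** The derivative along [[c, d]] is the ordinary one inside []a, b[], and the fundamental theorem
    asks for no more. The smaller interval serves to split [[0, 1]] at a point. *)
Lemma Rintegral_derive_in c d f a b :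
  (forall x, c <= x <= d -> derivable_in `[c, d] f x) ->
  {within `[c, d], continuous (derive_in `[c, d] f)} ->
  c <= a -> a < b -> b <= d ->
  \int[mu]_(x in `[a, b]) derive_in `[c, d] f x = f b - f a.
Proof.
move=> df cg ca ab bd.
have cdab : [set` `[a, b]] `<=` `[c, d].
  by apply: subset_itvScc; rewrite bnd_simp.
have cf := continuous_subspaceW cdab (derivable_in_continuous df).
have dfab x : x \in `]a, b[ -> is_derive x 1 f (derive_in `[c, d] f x).
  move=> xab; have xcd := itv_interior ca bd xab.
  apply: (has_slope_interior xcd); apply/derive_inP/df.
  by have := nbhs_singleton xcd; rewrite /= in_itv.
rewrite /Rintegral (continuous_FTC2 ab (F := f)) //.
- exact: continuous_subspaceW cg.
- have /(continuous_within_itvP _ ab)[_ fa fb] := cf.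
  by split=> // x /dfab [].
- by move=> x /dfab ?; rewrite derive1E derive_val.
Qed.

(** Cauchy-Schwarz for the derivative against the constant 1. *)
Lemma sqr_increment_le c d f a b :
  (forall x, c <= x <= d -> derivable_in `[c, d] f x) ->
  {within `[c, d], continuous (derive_in `[c, d] f)} ->
  c <= a -> a < b -> b <= d ->
  (f b - f a) ^+ 2 <= (b - a) * \int[mu]_(x in `[a, b]) derive_in `[c, d] f x ^+ 2.
Proof.
move=> df cg ca ab bd; set g := derive_in _ _ in cg *.
have cdab : [set` `[a, b]] `<=` `[c, d].
  by apply: subset_itvScc; rewrite bnd_simp.
have cgab := continuous_subspaceW cdab cg.
have ba : 0 < b - a by rewrite subr_gt0.
(* Integrate [g^2 >= 2 k g - k^2] for [k] the mean value of [g]. *)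
pose k := (f b - f a) / (b - a).
have ig := continuous_integrable cgab.
have ikg : mu.-integrable `[a, b] (EFin \o (fun x => (2 * k) * g x)).
  apply: continuous_integrable; apply: within_continuousM => //.
  exact: within_continuous_cst.
have ik2 : mu.-integrable `[a, b] (EFin \o (fun=> k ^+ 2)).
  exact/continuous_integrable/within_continuous_cst.
have : \int[mu]_(x in `[a, b]) (2 * k * g x - k ^+ 2) <=
       \int[mu]_(x in `[a, b]) g x ^+ 2.
  apply: le_Rintegral => //.
  - by have := integrableB _ ikg ik2; apply.
  - exact: (continuous_integrable (within_continuousM cgab cgab)).
  - by move=> x _; rewrite -subr_ge0; have := sqr_ge0 (g x - k); congr (0 <= _); ring.
rewrite RintegralB// RintegralZl// (Rintegral_derive_in df cg ca ab bd).
have muab : fine (mu [set` `[a, b]]) = b - a.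
  by rewrite lebesgue_measure_itv /= lte_fin ab.
rewrite Rintegral_cst// [fine _]muab => /(ler_wpM2l (ltW ba)); apply: le_trans.
rewrite le_eqVlt; apply/orP; left; apply/eqP; rewrite /k.
by field; rewrite gt_eqF.
Qed.

(** The increment bounds on [[0, x]] and [[x, 1]], weighted by [1 - x] and [x], add up to the claim
    because [f] vanishes at both ends. *)
Lemma sqr_le_Dirichlet f x :
  (forall x, 0 <= x <= 1 -> derivable_in `[0, 1] f x) ->
  {within `[0, 1], continuous (derive_in `[0, 1] f)} ->
  f 0 = 0 -> f 1 = 0 -> 0 <= x <= 1 ->
  f x ^+ 2 <= x * (1 - x) * \int[mu]_(z in `[0, 1]) derive_in `[0, 1] f z ^+ 2.
Proof.
move=> df cg f0 f1 /andP[]; rewrite le_eqVlt => /predU1P[<- _|x0].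
  by rewrite f0 !mul0r expr0n.
rewrite le_eqVlt => /predU1P[->|x1]; first by rewrite f1 subrr mulr0 !mul0r expr0n.
have := sqr_increment_le df cg (lexx 0) x0 (ltW x1).
have := sqr_increment_le df cg (ltW x0) x1 (lexx 1).
rewrite f0 f1 subr0 sub0r sqrrN subr0; set g := derive_in _ _ in cg *.
have ig2 : mu.-integrable `[0, 1] (EFin \o (fun z => g z ^+ 2)).
  exact: (continuous_integrable (within_continuousM cg cg)).
have := @Rintegral_itvB R (fun z => g z ^+ 2) (BLeft 0) (BRight 1) x ig2.
rewrite !bnd_simp => /(_ (ltW x0) (ltW x1)).
rewrite (@Rintegral_itv_obnd_cbnd R x (BRight 1)); last first.
  by apply: integrableS ig2 => //; apply: subset_itv; rewrite bnd_simp// ltW.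
set I := \int[mu]_(_ in `[0, 1]) _; set I0 := \int[mu]_(_ in `[0, x]) _.
move=> <- h1 h0.
have {}h1 := ler_wpM2l (ltW x0) h1.
have h : 0 <= 1 - x by rewrite subr_ge0 ltW.
have {}h0 := ler_wpM2l h h0.
have {h0 h1} := lerD h0 h1; congr (_ <= _); ring.
Qed.

Lemma continuous_parabola : continuous (fun z : R => z * (1 - z)).
Proof.
by move=> z; apply: cvgM; [exact: cvg_id|apply: cvgB; [exact: cvg_cst|exact: cvg_id]].
Qed.

Lemma Rintegral_parabola : \int[mu]_(z in `[0, 1]) (z * (1 - z)) = 6^-1 :> R.
Proof.
pose F (z : R) := 2^-1 * z ^+ 2 - 3^-1 * z ^+ 3.
have dF (z : R) : is_derive z 1 F (z * (1 - z)).
  by apply: is_derive_eq; rewrite /GRing.scale /=; field.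
rewrite /Rintegral (@continuous_FTC2 _ _ F)//=.
- by rewrite /F !expr0n !expr1n /= !mulr0 !mulr1 subr0; field.
- exact/continuous_subspaceT/continuous_parabola.
- have cF (z : R) : F @ z --> F z by apply/differentiable_continuous/derivable1_diffP.
  by split=> //; [exact: cvg_at_right_filter|exact: cvg_at_left_filter].
- by move=> z _; rewrite derive1E derive_val.
Qed.

Lemma Poincare_sixth f :
  (forall x, 0 <= x <= 1 -> derivable_in `[0, 1] f x) ->
  {within `[0, 1], continuous (derive_in `[0, 1] f)} ->
  f 0 = 0 -> f 1 = 0 ->
  6 * \int[mu]_(z in `[0, 1]) (f z ^+ 2) <=
  \int[mu]_(z in `[0, 1]) derive_in `[0, 1] f z ^+ 2.
Proof.
move=> df cg f0 f1; set I := \int[mu]_(_ in _) (derive_in _ _ _ ^+ 2).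
have cf := derivable_in_continuous df.
have ipar : mu.-integrable `[0, 1] (EFin \o (fun z : R => z * (1 - z))).
  by apply/continuous_integrable/continuous_subspaceT; exact: continuous_parabola.
have : \int[mu]_(z in `[0, 1]) (f z ^+ 2) <= \int[mu]_(z in `[0, 1]) (z * (1 - z) * I).
  apply: le_Rintegral => //.
  - exact: (continuous_integrable (within_continuousM cf cf)).
  - by have := integrableZr _ I ipar; apply.
  - by move=> x; rewrite /= in_itv /= => x01; exact: sqr_le_Dirichlet.
by rewrite RintegralZr// Rintegral_parabola -ler_pdivlMl.
Qed.

End interval_inequalities.

(** * A barrier argument for a differentiable function of time *)

Section trapping.
Context {R : realType}.

(** Above [L] the function decreases, so it has no maximum above [L] at a positive time, and at time
    0 it is not above [L]. *)
Lemma trapping (V : R -> R) (L : R) :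
  (forall t, 0 <= t -> derivable_in `[0, +oo[ V t) ->
  V 0 <= L ->
  (forall t, 0 <= t -> L < V t -> derive_in `[0, +oo[ V t < 0) ->
  forall t, 0 <= t -> V t <= L.
Proof.
move=> dV V0 dec t t0; rewrite leNgt; apply/negP => LVt.
have cV : {within `[0, t], continuous V}.
  apply/subspace_continuousP => s; rewrite /= in_itv /= => /andP[s0 _].
  apply: cvg_trans (derivable_in_cvg (dV _ s0)); apply: cvg_app.
  by apply: within_subset => r; rewrite /= !in_itv /= => /andP[->].
(* At a maximum point of [V] on [0, t] the left difference quotients are >= 0. *)
have [c] := EVT_max t0 cV; rewrite in_itv /= => /andP[c0 ct] Vc.
have LVc : L < V c by apply: lt_le_trans LVt (Vc _ _); rewrite in_itv /= t0 lexx.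
have {}c0 : 0 < c.
  by move: c0; rewrite le_eqVlt => /predU1P[cE|//]; rewrite ltNge -cE V0 in LVc.
have sub : [set` `[0, c]] `<=` `[0, +oo[.
  by move=> r; rewrite /= !in_itv /= => /andP[->].
(* Restricting to [[0, c]] keeps the limit and leaves only the left difference quotients. *)
have sl := has_slope_subset sub (derive_inP (dV c (ltW c0))).
have PF : ProperFilter (within `[0, c] c^').
  by apply: (@proper_within_itv _ _ 0 c) => //; rewrite (ltW c0) lexx.
have := dec _ (ltW c0) LVc; apply/negP; rewrite -leNgt.
rewrite -(has_slope_derive PF sl); apply: limr_ge; first by apply/cvg_ex; eexists; exact: sl.
apply: filterS (@near_withinT _ c^' [set` `[0, c]] _) => s.
rewrite /= in_itv /= => /andP[s0 sc].
rewrite /slope -mulrNN -invrN !opprB divr_ge0 ?subr_ge0//.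
by apply: Vc; rewrite in_itv /= s0 (le_trans sc).
Qed.

End trapping.

(** * Algebraic estimates on the constants and the pointwise dissipation inequality *)

Section estimates.
Context {R : realType}.
Implicit Types a b d e eta v A B D F K L S Q Y : R.

(** If [v] exceeds 1/2, the hypothesis gives [1 - v ^+ 2 > v]; otherwise [v ^+ 2] is at most 1/4.
    The value 1/4 is the one that makes [4 * a - 1] nonnegative in [gain_bound]. *)
Lemma speed_bound v : 0 <= v -> 0 < 1 - v - v ^+ 2 -> 4^-1 <= 1 - v ^+ 2 <= 1.
Proof.
move=> v0 hv; rewrite lerBlDr lerDl sqr_ge0 andbT.
have [v2|v2] := leP v 2^-1; last by lra.
have : v * v <= 2^-1 * 2^-1 by apply: ler_pM.
by rewrite -expr2; lra.
Qed.

(** The two entries of the maximum are treated separately. For [K], the factor [1 + d ^+ 2 / 6] is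
    at most [4 * a * K0]; for the other entry everything reduces to a polynomial in [d]. *)
Lemma gain_bound a d K : 4^-1 <= a -> 0 < d ->
  1 + d * ((1 + 2 * d / pi) / (pi * a)) <= K ->
  (1 + d ^+ 2 / 6) * Num.max (1 + d * (5 / 12 + d / 3) / a) K <= 4 * a * K ^+ 2.
Proof.
move=> a4 d0 hK; have a0 : 0 < a by lra.
have p0 : 0 < pi :> R := pi_gt0 R.
have p4 : pi < 4 :> R by have := @pihalf_lt2 R; lra.
(* [K0] is the given lower bound of [K] with [pi] replaced by [4]. *)
pose K0 := 1 + d * (1 + d / 2) / (4 * a).
have K0K : K0 <= K.
  apply: le_trans hK; rewrite /K0 lerD2l -mulrA ler_pM2l//.
  have q4 : 4^-1 <= pi^-1 :> R by rewrite lef_pV2 ?posrE// ltW.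
  rewrite [leRHS](_ : _ = (1 + 2 * d / pi) / pi / a); last by rewrite invfM mulrA.
  rewrite invfM mulrA ler_pM2r ?invr_gt0//.
  have dq : d * 4^-1 <= d / pi by rewrite ler_pM2l.
  have dq0 : 0 <= d / pi by rewrite divr_ge0 ?ltW.
  apply: ler_pM => //; lra.
have aK0 : 4 * a * K0 = 4 * a + d + d ^+ 2 / 2.
  by rewrite /K0; field; rewrite gt_eqF.
have d20 : 0 <= d ^+ 2 := sqr_ge0 d.
have K00 : 1 <= K0 by rewrite /K0 lerDl divr_ge0// ?mulr_ge0// ?addr_ge0 ?divr_ge0 ?ltW.
have aK : 4 * a * K0 <= 4 * a * K by rewrite ler_pM2l ?mulr_gt0.
have K_ge0 : 0 <= K by lra.
rewrite maxr_pMr ?ge_max; last by lra.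
apply/andP; split; last first.
  by rewrite expr2 mulrA ler_wpM2r//; lra.
apply: (@le_trans _ _ (4 * a * K0 ^+ 2)); last first.
  by rewrite ler_pM2l ?mulr_gt0// ler_sqr// nnegrE; lra.
rewrite -(ler_pM2l a0) -subr_ge0.
(* Each coefficient is nonnegative for [a >= 1/4]. The margin [1 / 16 - 1 / 18] in degree four shows
   how little room the replacement of [pi] by 4 leaves. *)
have -> : a * (4 * a * K0 ^+ 2) - a * ((1 + d ^+ 2 / 6) * (1 + d * (5 / 12 + d / 3) / a)) =
  a * (4 * a - 1) + d * (2 * a - 5 / 12) + d ^+ 2 * (5 / 6 * a - 1 / 12)
  + d ^+ 3 * (1 / 4 - 5 / 72) + d ^+ 4 * (1 / 16 - 1 / 18).
  by rewrite /K0; field; rewrite gt_eqF.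
have d3 : 0 <= d ^+ 3 by rewrite exprn_ge0// ltW.
have d4 : 0 <= d ^+ 4 by rewrite exprn_ge0// ltW.
rewrite !addr_ge0// ?mulr_ge0//; lra.
Qed.

(** Pointwise form of the energy inequality: [Y, A, A', B, Q, T, S, F] stand for
    the values of [y, y_t, y_tt, y_x, y_xt], of the tension, of its
    [x]-derivative and of the force. After integration over [0, 1] the terms
    with factors [-1] and [v] vanish and, by the Poincare inequality, the last
    term of the left-hand side is nonnegative. *)
Lemma dissipation_bound a b d e eta v K D Y A A' B Q S T F :
  0 < a <= 1 -> 0 < b -> 0 < d -> 0 < eta -> 0 <= v -> 0 < e ->
  1 + d * (5 / 12 + d / 3) / a <= K -> 1 + d * (2 * eta / b) <= K ->
  D = (2 * d - e * K) * a - 2 * d * v -> 0 < D ->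
  A' + 2 * d * A + 2 * v * Q = S + F ->
  T = a * B + b / 2 * (B * (B * B)) + eta * ((B * B) * Q) ->
  ((A + d * Y) * A' + d * A * A + 2 * d ^+ 2 * (Y * A)
    + (a * B + (b / 2 + d * eta) * B ^+ 3) * Q)
  + -1 * ((A + d * Y) * S + (Q + d * B) * T)
  + v * ((A + 2 * d * Y) * Q + (Q + 2 * d * B) * A)
  + e * (2^-1 * (A * A) + a / 2 * (B * B)
         + (b / 8 + d * eta / 4) * ((B * B) * (B * B))
         + d * (Y * A) + d ^+ 2 * (Y * Y))
  + (D / 2 + e * (5 * d / 24 + d ^+ 2 / 6)) * (B ^+ 2 + -6 * Y ^+ 2)
  <= (1 + d ^+ 2 / 6) / (2 * D) * F ^+ 2.
Proof.
move=> /andP[a0 a1] b0 d0 eta0 v0 e0 Ka Kb DE D0 A'E ->.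
(* Clearing denominators. The constants 5/12 and 1/3 are exactly those that make the coefficient of
   [B ^+ 2] in [cB] nonnegative. *)
have {}Ka : e * (a + 5 / 12 * d + d ^+ 2 / 3) <= e * K * a.
  rewrite -[leRHS]mulrA ler_pM2l//; apply: le_trans (ler_wpM2r (ltW a0) Ka).
  by rewrite le_eqVlt; apply/orP; left; apply/eqP; field; rewrite gt_eqF.
have {}Kb : e * (b + 2 * d * eta) <= e * K * b.
  rewrite -[leRHS]mulrA ler_pM2l//; apply: le_trans (ler_wpM2r (ltW b0) Kb).
  by rewrite le_eqVlt; apply/orP; left; apply/eqP; field; rewrite gt_eqF.
have vd : 0 <= v * d by rewrite mulr_ge0// ltW.
have c0 : 0 < 2 * d - e * K.
  rewrite -(pmulr_lgt0 _ a0); lra.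
have KA : e * (1 + 2 / 5 * d) <= e * K.
  rewrite -(ler_pM2r a0); apply: le_trans Ka; rewrite -[leLHS]mulrA ler_pM2l//.
  have : d * a <= d by rewrite ler_piMr// ltW.
  have := sqr_ge0 d; lra.
have cA : 0 <= d - e / 2 - e * d / 5 - D / 2 - v * d.
  have : (2 * d - e * K) * a <= 2 * d - e * K by rewrite ler_piMr// ltW.
  by rewrite DE; lra.
have cB : 0 <= d * a - e * a / 2 - e * (5 * d / 24 + d ^+ 2 / 6) - D / 2 - v * d.
  by rewrite DE; lra.
have cQ : 0 <= d * b / 2 - e * (b / 8 + d * eta / 4).
  have : e * K * b <= 2 * d * b by rewrite ler_pM2r//; lra.
  have : 0 < d * b by rewrite mulr_gt0.
  lra.
have {A'E} -> : A' = S + F - 2 * d * A - 2 * v * Q by rewrite -A'E; ring.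
rewrite -subr_ge0.
set X := (X in 0 <= X).
(* Completing squares: the [D] terms absorb the products of [F] with [A] and [Y],
   [v * d * (A - B) ^+ 2] absorbs the transport term [2 * v * d * A * B], and the weight 5/4 absorbs
   [e * d * (Y * A)]. The negative multiple of [Y ^+ 2] lent by the Poincare term pays for the
   squares in [Y]. *)
have -> : X = eta * (B * Q) ^+ 2 + D / 2 * (A - F / D) ^+ 2
  + 3 * D * (Y - d * F / (6 * D)) ^+ 2 + v * d * (A - B) ^+ 2
  + e * d * (5 / 4) * (Y - 2 / 5 * A) ^+ 2
  + (d - e / 2 - e * d / 5 - D / 2 - v * d) * A ^+ 2
  + (d * a - e * a / 2 - e * (5 * d / 24 + d ^+ 2 / 6) - D / 2 - v * d) * B ^+ 2
  + (d * b / 2 - e * (b / 8 + d * eta / 4)) * (B ^+ 2) ^+ 2.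
  by rewrite /X; field; rewrite gt_eqF.
by rewrite !addr_ge0// mulr_ge0 ?sqr_ge0// ?mulr_ge0// ltW// ?divr_gt0 ?mulr_gt0.
Qed.

End estimates.

(** * The norms of the two function spaces *)

Section norms.
Context {R : realType}.
Local Notation mu := (@lebesgue_measure R).
Implicit Types (u F : R -> R -> R) (c : R).

Lemma Xinfty_norm_le u c :
  (forall x t : R, 0 < x < 1 -> 0 <= t -> `|u x t| <= c) ->
  (Xinfty_norm u <= c%:E)%E.
Proof.
move=> uc; apply: ge_ereal_sup => _ [t /= + <-]; rewrite in_itv /= andbT => t0.
apply: ge_ereal_sup => _ [x /= + <-]; rewrite in_itv /= => x01.
by rewrite lee_fin uc.
Qed.

Lemma Xinfty_bound F : Xinfty F -> exists2 c : R, 0 <= c &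
  forall x t : R, 0 < x < 1 -> 0 <= t -> `|F x t| <= c.
Proof.
move=> [_ Foo].
have Fle (x t : R) : 0 < x < 1 -> 0 <= t -> (`|F x t|%:E <= Xinfty_norm F)%E.
  move=> x01 t0.
  apply: (@le_trans _ _ (ereal_sup [set `|F x t|%:E | x in `]0, 1[])).
    by apply: ereal_sup_ubound; exists x => //=; rewrite in_itv.
  by apply: ereal_sup_ubound; exists t => //=; rewrite in_itv /= t0.
(* Evaluating at the midpoint shows that the supremum is nonnegative, hence not [-oo]. *)
have h2 : 0 < (2^-1 : R) < 1 by lra.
have F0 : (0 <= Xinfty_norm F)%E.
  by apply: le_trans (Fle _ _ h2 (lexx _)); rewrite lee_fin.
have Ffin : Xinfty_norm F \is a fin_num by rewrite ge0_fin_numE.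
exists (fine (Xinfty_norm F)); first exact: fine_ge0.
by move=> x t x01 t0; rewrite -lee_fin fineK//; exact: Fle.
Qed.

(** Boundedness of [F] makes its norm a real number [N], so that the energy argument can be carried
    out with real integrals. *)
Lemma X2_norm_energy F : Xinfty F -> exists N : R, [/\ 0 <= N, X2_norm F = N%:E &
  forall t : R, 0 <= t ->
    mu.-integrable `]0, 1[ (EFin \o (fun x => F x t ^+ 2)) /\
    \int[mu]_(x in `]0, 1[) (F x t ^+ 2) <= N ^+ 2].
Proof.
move=> FX; have [c c0 Fc] := Xinfty_bound FX; have [mF _] := FX.
have mu01 : mu `]0%R, 1%R[%classic = 1%E.
  by rewrite lebesgue_measure_itv /= lte_fin ltr01 oppr0 adde0.
have mF2 (t : R) : 0 <= t -> measurable_fun (`]0, 1[ : set R) (fun x => F x t ^+ 2).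
  by move=> t0; apply: measurable_funX; exact: mF.
have F2c (x t : R) : 0 < x < 1 -> 0 <= t -> F x t ^+ 2 <= c ^+ 2.
  by move=> x01 t0; rewrite -(real_normK (num_real _)) ler_sqr ?nnegrE// Fc.
have iF (t : R) : 0 <= t -> mu.-integrable `]0, 1[ (EFin \o (fun x => F x t ^+ 2)).
  move=> t0; apply: measurable_bounded_integrable => //.
  - by rewrite [ltLHS]mu01 ltry.
  - exact: mF2.
  - exists (c ^+ 2); split; first exact: num_real.
    move=> M cM x; rewrite /= in_itv /= => x01.
    by rewrite ger0_norm ?sqr_ge0// (le_trans (F2c _ _ x01 t0))// ltW.
pose I t := \int[mu]_(x in `]0, 1[) (F x t ^+ 2).
have I0 (t : R) : 0 <= I t by apply: Rintegral_ge0 => x _; exact: sqr_ge0.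
have IE (t : R) : 0 <= t -> ((\int[mu]_(x in `]0%R, 1%R[) (`|F x t| ^+ 2)%:E) `^ 2^-1
    = (Num.sqrt (I t))%:E)%E.
  move=> t0; under eq_integral do rewrite (real_normK (num_real _)).
  by rewrite -powR12_sqrt// -poweR_EFin /I /Rintegral fineK// integrable_fin_num// iF.
have Ic (t : R) : 0 <= t -> I t <= c ^+ 2.
  move=> t0; apply: (@le_trans _ _ (\int[mu]_(x in `]0, 1[) (c ^+ 2))).
    apply: le_Rintegral => //; first exact: iF.
    - have ic : mu.-integrable `[0, 1] (EFin \o (fun=> c ^+ 2)).
        exact/continuous_integrable/within_continuous_cst.
      by apply: integrableS ic => //; apply: subset_itv; rewrite bnd_simp.
    - by move=> x; rewrite /= in_itv /= => x01; exact: F2c.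
  by rewrite Rintegral_cst// [fine _](congr1 fine mu01) mulr1.
have Nc : (X2_norm F <= c%:E)%E.
  apply: ge_ereal_sup => _ [t /= + <-]; rewrite in_itv /= andbT => t0.
  by rewrite IE// lee_fin -(ger0_norm c0) -sqrtr_sqr ler_sqrt ?sqr_ge0 ?Ic.
have IN (t : R) : 0 <= t -> ((Num.sqrt (I t))%:E <= X2_norm F)%E.
  by move=> t0; rewrite -IE//; apply: ereal_sup_ubound; exists t; rewrite //= in_itv /= t0.
have N0 : (0 <= X2_norm F)%E by apply: le_trans (IN _ (lexx 0)); rewrite lee_fin sqrtr_ge0.
have Nfin : X2_norm F \is a fin_num by rewrite ge0_fin_numE// (le_lt_trans Nc)// ltry.
exists (fine (X2_norm F)); split; [exact: fine_ge0|by rewrite fineK|move=> t t0].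
split; first exact: iF.
rewrite -/(I t) -(sqr_sqrtr (I0 t)) ler_sqr ?nnegrE ?sqrtr_ge0 ?fine_ge0//.
by rewrite -lee_fin fineK// IN.
Qed.

End norms.

(** * Further slope rules and properness on the domains in use *)

Section more_slopes.
Context {R : realType}.
Implicit Types (A : set R) (f g : R -> R) (a c l m : R).

(** Lets the rules compute a derivative mechanically, its desired form being checked afterwards by
    algebra. *)
Lemma has_slope_eq A f a l m : has_slope A f a l -> l = m -> has_slope A f a m.
Proof. by move=> + <-. Qed.

Lemma has_slopeZ A c f a l : has_slope A f a l ->
  has_slope A (fun s => c * f s) a (c * l).
Proof.
move=> fl; apply: has_slope_eq (has_slopeM (has_slope_cst A c a) fl) _.
by rewrite mul0r add0r.
Qed.

(** Values off [A] do not enter the limit; this matters since [y] is prescribed only on its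
    domain. *)
Lemma has_slope_const_on A f a c : A a -> (forall s, A s -> f s = c) ->
  has_slope A f a 0.
Proof.
move=> Aa fc; apply: cvg_trans (has_slope_cst A c a); apply: near_eq_cvg.
by rewrite near_withinE; apply: nearW => s As; rewrite /slope !fc.
Qed.

Lemma proper_unit_itv a : 0 <= a <= 1 -> ProperFilter (within `[0, 1] a^').
Proof. by move=> a01; apply: (proper_within_itv _ a01). Qed.

Lemma proper_half_line a : 0 <= a -> ProperFilter (within `[0, +oo[ a^').
Proof.
move=> a0; apply: (@proper_within_itv _ _ 0 (a + 1)).
- by rewrite ltr_wpDl.
- by rewrite a0 lerDl ler01.
- by move=> s; rewrite /= !in_itv /= => /andP[->].
Qed.

End more_slopes.

(** * Linear combinations of integrals over the unit interval *)

Section integrals_over_the_unit_interval.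
Context {R : realType}.
Local Notation mu := (@lebesgue_measure R).
Implicit Types (f g : R -> R) (c r s t : R) (p q : R -> R -> R).

(** Pairing the value with integrability carries the latter through linear combinations. *)
Definition has_int f r :=
  mu.-integrable `[0, 1] (EFin \o f) /\ \int[mu]_(x in `[0, 1]) f x = r.

Lemma has_intD f g r s : has_int f r -> has_int g s ->
  has_int (fun x => f x + g x) (r + s).
Proof.
move=> [fi <-] [gi <-]; split; last by rewrite RintegralD.
by have := integrableD _ fi gi; apply.
Qed.

Lemma has_intZ c f r : has_int f r -> has_int (fun x => c * f x) (c * r).
Proof.
move=> [fi <-]; split; last by rewrite RintegralZl.
by have := integrableZl _ c fi; apply.
Qed.

(** The end points are negligible, and the string equation is available only between them. *)
Lemma has_int_le_oo f g r : has_int f r ->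
  mu.-integrable `]0, 1[ (EFin \o g) ->
  (forall x, 0 < x < 1 -> f x <= g x) ->
  r <= \int[mu]_(x in `]0, 1[) g x.
Proof.
move=> [fi <-] gi fg.
have fio : mu.-integrable `]0, 1[ (EFin \o f).
  by apply: integrableS fi => //; apply: subset_itv; rewrite bnd_simp.
rewrite /Rintegral integral_itv_bndoo; last exact: measurable_int fio.
by apply: le_Rintegral => // x; rewrite /= in_itv /=; exact: fg.
Qed.

(** The boundary terms vanish with [p]. Such a null integral can be added to the energy balance with
    any factor. *)
Lemma int_by_parts_has_int p q t : int_by_parts p q -> 0 <= t ->
  p 0 t = 0 -> p 1 t = 0 ->
  has_int (fun x => p x t * Dx q x t + Dx p x t * q x t) 0.
Proof.
move=> pq t0 p0 p1; have [i1 i2 E] := pq t t0.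
split; first by have := integrableD _ i1 i2; apply.
rewrite RintegralD//; move: E; rewrite /int_x => ->.
by rewrite p0 p1 !mul0r subrr sub0r addNr.
Qed.

End integrals_over_the_unit_interval.

(** The generators form a left-nested union, so membership is a path of [left] and [right]. *)
Ltac poly_expr_tac := repeat first
  [ by apply: poly_cst
  | by apply: poly_gen; first
      [ by right | by left; right | by left; left; right | by left; left
      | by left; left; left ]
  | apply: poly_mul | apply: poly_add ].

(** * Derivatives of the tension and of the Lyapunov density *)

Section slopes_of_densities.
Context {R : realType} (b delta eta v : R) (A : set R) (z : R).
Implicit Types (f g h : R -> R) (l m n : R).

Lemma has_slope_tension f g l m : has_slope A f z l -> has_slope A g z m ->
  has_slope A (fun s => (1 - v ^+ 2) * f s + b / 2 * (f s * (f s * f s))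
                        + eta * ((f s * f s) * g s)) z
    ((1 - v ^+ 2 + 3 / 2 * b * f z ^+ 2) * l
     + 2 * eta * f z * l * g z + eta * f z ^+ 2 * m).
Proof.
move=> B Q; apply: has_slope_eq.
  apply: has_slopeD; [apply: has_slopeD|].
  - exact: has_slopeZ B.
  - exact: has_slopeZ (has_slopeM B (has_slopeM B B)).
  - exact: has_slopeZ (has_slopeM (has_slopeM B B) Q).
by rewrite /=; field.
Qed.

(** Here [f], [g], [h] stand for [y], [y_t], [y_x] as functions of time, and [l], [m], [n] for their
    time derivatives. *)
Lemma has_slope_energy f g h l m n :
  has_slope A f z l -> has_slope A g z m -> has_slope A h z n ->
  has_slope A (fun s => 2^-1 * (g s * g s) + (1 - v ^+ 2) / 2 * (h s * h s)
      + (b / 8 + delta * eta / 4) * ((h s * h s) * (h s * h s))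
      + delta * (f s * g s) + delta ^+ 2 * (f s * f s)) z
    ((g z + delta * f z) * m + delta * l * g z
     + 2 * delta ^+ 2 * (f z * l)
     + ((1 - v ^+ 2) * h z + (b / 2 + delta * eta) * h z ^+ 3) * n).
Proof.
move=> Y A' B; apply: has_slope_eq.
  apply: has_slopeD; [apply: has_slopeD; [apply: has_slopeD; [apply: has_slopeD|]|]|].
  - exact: has_slopeZ (has_slopeM A' A').
  - exact: has_slopeZ (has_slopeM B B).
  - exact: has_slopeZ (has_slopeM (has_slopeM B B) (has_slopeM B B)).
  - exact: has_slopeZ (has_slopeM Y A').
  - exact: has_slopeZ (has_slopeM Y Y).
by rewrite /=; field.
Qed.

End slopes_of_densities.

(** * Derivatives, boundary values and initial values along a solution *)

Section energy_estimate.
Context {R : realType} (b delta eta v : R) (F y : R -> R -> R).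
Context (sol : string_solution b delta eta v F y).
Local Notation a := (1 - v ^+ 2).
Local Notation mu := (@lebesgue_measure R).

(** The integrand of the Lyapunov function [V], with powers of the unknowns written as products so
    that it is visibly a [poly_expr]. *)
Definition energy_density (x t : R) : R :=
  2^-1 * (Dt y x t * Dt y x t) + a / 2 * (Dx y x t * Dx y x t)
  + (b / 8 + delta * eta / 4) * ((Dx y x t * Dx y x t) * (Dx y x t * Dx y x t))
  + delta * (y x t * Dt y x t) + delta ^+ 2 * (y x t * y x t).

(** The equation reads [y_tt + 2 delta y_t + 2 v y_xt = tension_x + F]. *)
Definition tension (x t : R) : R :=
  a * Dx y x t + b / 2 * (Dx y x t * (Dx y x t * Dx y x t))
  + eta * ((Dx y x t * Dx y x t) * Dx (Dt y) x t).

(** The multiplier in the integrations by parts: [c = delta] against the tension, [c = 2 * delta]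
    against [y_t] for the transport term. *)
Definition damped_velocity (c x t : R) : R := Dt y x t + c * y x t.

Let reg := solution_regular sol.

Lemma Dx_tension x t : 0 <= x <= 1 -> 0 <= t ->
  Dx tension x t = (1 - v ^+ 2 + 3 / 2 * b * Dx y x t ^+ 2) * Dx (Dx y) x t
    + 2 * eta * Dx y x t * Dx (Dx y) x t * Dx (Dt y) x t
    + eta * Dx y x t ^+ 2 * Dx (Dx (Dt y)) x t.
Proof.
move=> x01 t0; apply: has_slope_derive; first exact: proper_unit_itv.
apply: has_slope_tension; first exact: derive_inP (regular_xx reg x01 t0).
exact: derive_inP (regular_xxt reg x01 t0).
Qed.

Lemma Dx_damped_velocity c x t : 0 <= x <= 1 -> 0 <= t ->
  Dx (damped_velocity c) x t = Dx (Dt y) x t + c * Dx y x t.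
Proof.
move=> x01 t0; apply: has_slope_derive; first exact: proper_unit_itv.
apply: has_slopeD; first exact: derive_inP (regular_xt reg x01 t0).
exact: has_slopeZ (derive_inP (regular_x reg x01 t0)).
Qed.

Lemma Dt_energy_density x t : 0 <= x <= 1 -> 0 <= t ->
  Dt energy_density x t = (Dt y x t + delta * y x t) * Dt (Dt y) x t
    + delta * Dt y x t * Dt y x t + 2 * delta ^+ 2 * (y x t * Dt y x t)
    + (a * Dx y x t + (b / 2 + delta * eta) * Dx y x t ^+ 3) * Dx (Dt y) x t.
Proof.
move=> x01 t0; rewrite -(regular_mixed reg x01 t0).
apply: has_slope_derive; first exact: proper_half_line.
apply: has_slope_energy; first exact: derive_inP (regular_t reg x01 t0).
  exact: derive_inP (regular_tt reg x01 t0).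
exact: derive_inP (regular_tx reg x01 t0).
Qed.

Lemma Dt_boundary t : 0 <= t -> Dt y 0 t = 0 /\ Dt y 1 t = 0.
Proof.
move=> t0; split; apply: has_slope_derive; try exact: proper_half_line;
  apply: (@has_slope_const_on _ _ _ _ 0); rewrite /= ?in_itv /= ?t0// => s;
  by rewrite /= in_itv /= andbT => s0; case: (solution_boundary sol s0).
Qed.

(** The initial conditions cover the open interval only; at the two corners the boundary conditions
    take over. Then [y_x] at time 0 is the derivative of the zero function. *)
Lemma initial_rest x : 0 <= x <= 1 -> [/\ y x 0 = 0, Dt y x 0 = 0 & Dx y x 0 = 0].
Proof.
have y0 z : 0 <= z <= 1 -> y z 0 = 0 /\ Dt y z 0 = 0.
  move=> /andP[]; rewrite le_eqVlt => /predU1P[<- _|z0].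
    by split; [case: (solution_boundary sol (lexx 0))|case: (Dt_boundary (lexx 0))].
  rewrite le_eqVlt => /predU1P[->|z1].
    by split; [case: (solution_boundary sol (lexx 0))|case: (Dt_boundary (lexx 0))].
  by apply: (solution_initial sol); rewrite z0.
move=> x01; have [yx0 ytx0] := y0 x x01; split=> //.
apply: has_slope_derive; first exact: proper_unit_itv.
apply: (@has_slope_const_on _ _ _ _ 0); first by rewrite /= in_itv.
by move=> s; rewrite /= in_itv /= => /y0[].
Qed.

Lemma poly_energy_density : poly_expr [set y; Dt y; Dx y] energy_density.
Proof. by rewrite /energy_density; poly_expr_tac. Qed.

Lemma poly_tension : poly_expr [set y; Dt y; Dx y; Dx (Dt y)] tension.
Proof. by rewrite /tension; poly_expr_tac. Qed.

Lemma poly_damped_velocity c :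
  poly_expr [set y; Dt y; Dx y; Dx (Dt y)] (damped_velocity c).
Proof. by rewrite /damped_velocity; poly_expr_tac. Qed.

Lemma poly_velocity : poly_expr [set y; Dt y; Dx y; Dx (Dt y)] (Dt y).
Proof. by poly_expr_tac. Qed.

Lemma damped_velocity_boundary c t : 0 <= t ->
  damped_velocity c 0 t = 0 /\ damped_velocity c 1 t = 0.
Proof.
move=> t0; rewrite /damped_velocity.
have [-> ->] := solution_boundary sol t0; have [-> ->] := Dt_boundary t0.
by rewrite mulr0 addr0.
Qed.

Lemma energy_initial : int_x energy_density 0 = 0.
Proof.
rewrite /int_x (@eq_Rintegral _ _ _ _ _ (fun=> 0)); last first.
  move=> x; rewrite inE /= in_itv /= => /initial_rest[y0 yt0 yx0].
  by rewrite /energy_density y0 yt0 yx0 !mulr0 !addr0.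
by rewrite Rintegral_cst// mul0r.
Qed.

End energy_estimate.

(** * The differential inequality for the Lyapunov function *)

Section energy_decay.
Context {R : realType} (b delta eta v : R) (F y : R -> R -> R).
Context (sol : string_solution b delta eta v F y).
Local Notation a := (1 - v ^+ 2).
Local Notation mu := (@lebesgue_measure R).
Local Notation p := (energy_density b delta eta v y).
Let reg := solution_regular sol.

Lemma string_continuous t : 0 <= t ->
  {within `[0, 1], continuous (y ^~ t)} /\ {within `[0, 1], continuous (Dx y ^~ t)}.
Proof.
by move=> t0; split; apply: derivable_in_continuous => x x01;
  [exact: regular_x reg _ _ x01 t0|exact: regular_xx reg _ _ x01 t0].
Qed.

Lemma string_Poincare t : 0 <= t -> exists IY IB : R,
  [/\ has_int (fun x => y x t ^+ 2) IY, has_int (fun x => Dx y x t ^+ 2) IB &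
      6 * IY <= IB].
Proof.
move=> t0; have [cy cyx] := string_continuous t0.
exists (\int[mu]_(x in `[0, 1]) (y x t ^+ 2)), (\int[mu]_(x in `[0, 1]) (Dx y x t ^+ 2)).
have [y0 y1] := solution_boundary sol t0.
split; [| |apply: (Poincare_sixth (f := y ^~ t)) => // x x01; exact: regular_x].
- by split=> //; exact: (continuous_integrable (within_continuousM cy cy)).
- by split=> //; exact: (continuous_integrable (within_continuousM cyx cyx)).
Qed.

(** Integral form of [dissipation_bound]: two null integrals and a nonnegative Poincare term are
    added to [V' + e V], and the integrands are then compared pointwise. *)
Lemma energy_decay (e K D N t : R) :
  0 < a <= 1 -> 0 < b -> 0 < delta -> 0 < eta -> 0 <= v -> 0 < e ->
  1 + delta * (5 / 12 + delta / 3) / a <= K -> 1 + delta * (2 * eta / b) <= K ->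
  D = (2 * delta - e * K) * a - 2 * delta * v -> 0 < D -> 0 <= t ->
  mu.-integrable `]0, 1[ (EFin \o (fun x => F x t ^+ 2)) ->
  \int[mu]_(x in `]0, 1[) (F x t ^+ 2) <= N ^+ 2 ->
  derive_in `[0, +oo[ (int_x p) t + e * int_x p t
    <= (1 + delta ^+ 2 / 6) / (2 * D) * N ^+ 2.
Proof.
move=> a01 b0 d0 eta0 v0 e0 Ka Kb DE D0 t0 iF FN.
have [ip idp _ dV] := regular_diff reg (poly_energy_density b delta eta v y) t0.
have hp : has_int (fun x => p x t) (int_x p t) by [].
have hdp : has_int (fun x => Dt p x t) (derive_in `[0, +oo[ (int_x p) t).
  by rewrite dV.
have [w0 w1] := damped_velocity_boundary sol delta t0.
have hT := int_by_parts_has_int (regular_parts reg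
  (poly_damped_velocity y delta) (poly_tension b eta v y)) t0 w0 w1.
have [z0 z1] := damped_velocity_boundary sol (2 * delta) t0.
have hv := int_by_parts_has_int (regular_parts reg
  (poly_damped_velocity y (2 * delta)) (poly_velocity y)) t0 z0 z1.
have [IY [IB [hY hB IYB]]] := string_Poincare t0.
pose lam := D / 2 + e * (5 * delta / 24 + delta ^+ 2 / 6).
pose M := (1 + delta ^+ 2 / 6) / (2 * D).
have lam0 : 0 <= lam.
  rewrite addr_ge0 ?mulr_ge0 ?addr_ge0 ?divr_ge0 ?mulr_ge0 ?sqr_ge0// ltW//.
have M0 : 0 <= M by rewrite divr_ge0 ?addr_ge0 ?divr_ge0 ?sqr_ge0 ?mulr_ge0// ltW.
(* The summands are assembled in the order of the left-hand side of [dissipation_bound]. *)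
have hG := has_intD (has_intD (has_intD (has_intD hdp (has_intZ (-1) hT))
  (has_intZ v hv)) (has_intZ e hp)) (has_intZ lam (has_intD hB (has_intZ (-6) hY))).
apply: (@le_trans _ _ (\int[mu]_(x in `]0, 1[) (M * F x t ^+ 2))); last first.
  by rewrite RintegralZl// ler_wpM2l.
apply: (@le_trans _ _ (derive_in `[0, +oo[ (int_x p) t + -1 * 0 + v * 0
    + e * int_x p t + lam * (IB + -6 * IY))).
  by rewrite !mulr0 !addr0 lerDl mulr_ge0//; lra.
apply: (has_int_le_oo hG).
  by have := integrableZl _ M iF; apply.
move=> x x01; have x01' : 0 <= x <= 1 by lra.
rewrite (Dt_energy_density sol x01' t0) !(Dx_damped_velocity sol _ x01' t0).
apply: (dissipation_bound _ a01 b0 d0 eta0 v0 e0 Ka Kb DE D0) => //.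
by rewrite (Dx_tension sol x01' t0); exact: solution_equation sol x t x01 t0.
Qed.

End energy_decay.

(** * From the energy inequality to a pointwise bound on the displacement *)

Section energy_bound.
Context {R : realType} (b delta eta v : R) (F y : R -> R -> R).
Context (sol : string_solution b delta eta v F y).
Local Notation a := (1 - v ^+ 2).
Local Notation mu := (@lebesgue_measure R).
Local Notation p := (energy_density b delta eta v y).
Let reg := solution_regular sol.

Lemma measurable_in_x_string : measurable_in_x y.
Proof.
move=> t t0; have [cy _] := string_continuous sol t0.
have my : measurable_fun ([set` `[0%R, 1%R]] : set R) (y ^~ t).
  exact: subspace_continuous_measurable_fun.
by apply: measurable_funS my => //; apply: subset_itv; rewrite bnd_simp.
Qed.

(** The terms in [y] and [y_t] form a sum of two squares, so [V] dominates [a / 2] times the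
    integral of [y_x ^+ 2], and [x * (1 - x)] is at most 1/4 in [sqr_le_Dirichlet]. *)
Lemma energy_coercive x t : 0 < a -> 0 < b -> 0 < delta -> 0 < eta ->
  0 <= x <= 1 -> 0 <= t -> 2 * a * y x t ^+ 2 <= int_x p t.
Proof.
move=> a0 b0 d0 eta0 x01 t0.
have [cy cyx] := string_continuous sol t0.
have [y0 y1] := solution_boundary sol t0.
have [ip _ _ _] := regular_diff reg (poly_energy_density b delta eta v y) t0.
have iB : mu.-integrable `[0, 1] (EFin \o (fun z => Dx y z t ^+ 2)).
  exact: (continuous_integrable (within_continuousM cyx cyx)).
set IB := \int[mu]_(z in `[0, 1]) (Dx y z t ^+ 2).
have IB0 : 0 <= IB by apply: Rintegral_ge0 => z _; exact: sqr_ge0.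
have yIB : y x t ^+ 2 <= x * (1 - x) * IB.
  apply: (sqr_le_Dirichlet (f := y ^~ t)) => // z z01.
  exact: regular_x.
have x4 : x * (1 - x) <= 4^-1 by have := sqr_ge0 (x - 2^-1); lra.
have IBV : a / 2 * IB <= int_x p t.
  rewrite -RintegralZl//; apply: le_Rintegral => //.
    by have := integrableZl _ (a / 2) iB; apply.
  move=> z _; rewrite /energy_density.
  rewrite -subr_ge0; set X := (X in 0 <= X).
  have -> : X = 2^-1 * (Dt y z t + delta * y z t) ^+ 2 + 2^-1 * (delta * y z t) ^+ 2
    + (b / 8 + delta * eta / 4) * (Dx y z t ^+ 2) ^+ 2 by rewrite /X; field.
  by rewrite !addr_ge0// mulr_ge0 ?sqr_ge0// ?addr_ge0// ltW// ?divr_gt0// mulr_gt0.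
apply: le_trans IBV; have := ler_wpM2r IB0 x4.
move=> /(le_trans yIB); rewrite -(ler_pM2l (_ : 0 < 2 * a)) ?mulr_gt0//.
lra.
Qed.

Lemma energy_bound (e K D N : R) :
  0 < a <= 1 -> 0 < b -> 0 < delta -> 0 < eta -> 0 <= v -> 0 < e ->
  1 + delta * (5 / 12 + delta / 3) / a <= K -> 1 + delta * (2 * eta / b) <= K ->
  D = (2 * delta - e * K) * a - 2 * delta * v -> 0 < D ->
  (forall t, 0 <= t -> mu.-integrable `]0, 1[ (EFin \o (fun x => F x t ^+ 2)) /\
    \int[mu]_(x in `]0, 1[) (F x t ^+ 2) <= N ^+ 2) ->
  forall t, 0 <= t -> e * int_x p t <= (1 + delta ^+ 2 / 6) / (2 * D) * N ^+ 2.
Proof.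
move=> a01 b0 d0 eta0 v0 e0 Ka Kb DE D0 FN t t0.
set M := (_ / _) * _.
have M0 : 0 <= M.
  by rewrite mulr_ge0 ?sqr_ge0// divr_ge0 ?addr_ge0 ?divr_ge0 ?sqr_ge0 ?mulr_ge0// ltW.
(* The barrier is [M / e]: above it [e * V > M], and [energy_decay] makes the derivative
   negative. *)
rewrite mulrC -ler_pdivlMr//; move: t t0; apply: trapping => [t t0||t t0].
- by have [] := regular_diff reg (poly_energy_density b delta eta v y) t0.
- by rewrite (energy_initial sol) divr_ge0// ltW.
- rewrite ltr_pdivrMr// mulrC => MV; have [iF FN2] := FN t t0.
  have := energy_decay sol a01 b0 d0 eta0 v0 e0 Ka Kb DE D0 t0 iF FN2.
  by rewrite -/M; lra.
Qed.

End energy_bound.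

(** * The displacement bound with the sharp-Poincare constant [K] *)

Theorem theorem3p1 (R : realType) (b delta eta v K eps : R)
    (F y : R -> R -> R)
    (b_gt0 : 0 < b) (delta_gt0 : 0 < delta) (eta_gt0 : 0 < eta)
    (v_ge0 : 0 <= v) (v_lt1 : v < 1)
    (KE : K = 1 + delta * Num.max ((1 + 2 * delta / pi) / (pi * (1 - v ^+ 2)))
                                  (2 * eta / b))
    (eps_gt0 : 0 < eps)
    (eps_lt : eps < 2 * delta * (1 - v - v ^+ 2) / (K * (1 - v ^+ 2)))
    (F_Xinfty : Xinfty F)
    (y_solution : string_solution b delta eta v F y) :
  [/\ Xinfty y,
      (Xinfty_norm y <=
       (Num.sqrt (K / (eps * ((2 * delta - eps * K) * (1 - v ^+ 2)
                              - 2 * delta * v))))%:E * X2_norm F)%E &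
      ((Num.sqrt (K / (eps * ((2 * delta - eps * K) * (1 - v ^+ 2)
                              - 2 * delta * v))))%:E * X2_norm F < +oo)%E].
Proof.
have [N [N0 NE FN]] := X2_norm_energy F_Xinfty.
have a0 : 0 < 1 - v ^+ 2 by rewrite subr_gt0 expr_lt1.
have KX : 1 + delta * ((1 + 2 * delta / pi) / (pi * (1 - v ^+ 2))) <= K.
  by rewrite KE lerD2l ler_pM2l// le_max lexx.
have Kb : 1 + delta * (2 * eta / b) <= K.
  by rewrite KE lerD2l ler_pM2l// le_max lexx orbT.
have K1 : 1 < K by apply: lt_le_trans Kb; rewrite ltrDl mulr_gt0// divr_gt0// mulr_gt0.
have K0 : 0 < K by lra.
move: eps_lt; rewrite ltr_pdivlMr ?mulr_gt0// => eps_lt.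
(* The mere existence of an admissible [eps] forces this. *)
have v1 : 0 < 1 - v - v ^+ 2.
  have : 0 < 2 * delta * (1 - v - v ^+ 2) by apply: lt_trans eps_lt; rewrite !mulr_gt0.
  by rewrite pmulr_rgt0// mulr_gt0.
have /andP[a4 a1] := speed_bound v_ge0 v1.
have gain := gain_bound a4 delta_gt0 KX.
set K' := Num.max _ _ in gain.
set D := _ - 2 * delta * v; set c := K / _.
have D0 : 0 < D by rewrite /D; lra.
have K'1 : 1 + delta * (5 / 12 + delta / 3) / (1 - v ^+ 2) <= K' by rewrite le_max lexx.
have K'K : K <= K' by rewrite le_max lexx orbT.
have K'0 : 0 < K' by lra.
pose e := eps * K / K'.
have e0 : 0 < e by rewrite divr_gt0 ?mulr_gt0.
have DE : D = (2 * delta - e * K') * (1 - v ^+ 2) - 2 * delta * v.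
  by rewrite /e divfK ?gt_eqF.
have a01 : 0 < 1 - v ^+ 2 <= 1 by rewrite a0 a1.
have energy := energy_bound y_solution a01 b_gt0 delta_gt0 eta_gt0 v_ge0 e0 K'1
  (le_trans Kb K'K) DE D0 FN.
have c0 : 0 <= c by rewrite divr_ge0 ?mulr_ge0// ltW.
have y2 (x t : R) : 0 < x < 1 -> 0 <= t -> y x t ^+ 2 <= c * N ^+ 2.
  move=> /andP[x0 x1] t0.
  have x01 : 0 <= x <= 1 by rewrite !ltW.
  have ae0 : 0 < e * (2 * (1 - v ^+ 2)) by rewrite (mulr_gt0 e0)// mulr_gt0.
  rewrite -(ler_pM2l ae0) -mulrA.
  have := energy_coercive y_solution a0 b_gt0 delta_gt0 eta_gt0 x01 t0.
  move=> /(ler_wpM2l (ltW e0))/le_trans; apply; apply: (le_trans (energy t t0)).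
  (* After inserting [e] and [c], comparing the coefficients of [N ^+ 2] amounts to [gain_bound],
     since [2 * a * e * c] equals [2 * a * K ^+ 2 / (K' * D)] for [a = 1 - v ^+ 2]. *)
  rewrite [leRHS]mulrA ler_wpM2r ?sqr_ge0// ler_pdivrMr ?mulr_gt0// -(ler_pM2r K'0).
  apply: (le_trans gain); rewrite le_eqVlt; apply/orP; left; apply/eqP.
  by rewrite /e /c; field; rewrite !gt_eqF.
have yN (x t : R) : 0 < x < 1 -> 0 <= t -> `|y x t| <= Num.sqrt c * N.
  move=> x01 t0; rewrite -sqrtr_sqr -(ger0_norm N0) -sqrtr_sqr -sqrtrM//.
  by rewrite ler_sqrt; [exact: y2|rewrite mulr_ge0 ?sqr_ge0].
have yle := Xinfty_norm_le yN.
rewrite NE -EFinM; split; [|exact: yle|exact: ltry].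
by split; [exact: measurable_in_x_string y_solution|exact: le_lt_trans yle (ltry _)].
Qed.
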